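(* Let $K,M\subset\{1,\dots,n\}$. Then $K\prec M$ (i.e. $W_M^-\cap W_K^+\neq\emptyset$) if and only if $K\vartriangleleft M$.
   Context: $E$ is a complex Hermitian vector space of dimension $n$ with a fixed orthonormal basis $e_1,\dots,e_n$; $\widehat E=E\oplus E$, $\mathbf e_i=(e_i,0)$, $\mathbf f_i=(0,e_i)$, $J(x,y)=(-y,x)$. $\mathrm{Lag}_h(\widehat E)$ is the set of complex subspaces $L\subset\widehat E$ with $L^\perp=JL$, topologized as a subset of the Grassmannian of $n$-dimensional subspaces of $\widehat E$. For $I\subset\{1,\dots,n\}$ with complement $I^c$ put $\Lambda_I=\mathrm{span}_{\mathbb C}\{\mathbf e_i,\mathbf f_j:i\in I,\ j\in I^c\}$. Fix reals $0<\alpha_1<\cdots<\alpha_n$, let $\widehat A\mathbf e_i=\alpha_i\mathbf e_i$, $\widehat A\mathbf f_i=-\alpha_i\mathbf f_i$, $\Psi^t(L)=e^{t\widehat A}L$, and $W_I^\pm=\{L\in\mathrm{Lag}_h(\widehat E):\lim_{t\to\infty}e^{\pm t\widehat A}L=\Lambda_I\}$ (these sets do not depend on the choice of the $\alpha_i$). $K\prec M$ means that there is a tunnelling from $\Lambda_M$ to $\Lambda_K$, i.e. some $L\in\mathrm{Lag}_h(\widehat E)$ with $\lim_{t\to\infty}\Psi^{-t}L=\Lambda_M$ and $\lim_{t\to\infty}\Psi^tL=\Lambda_K$; equivalently $W_M^-\cap W_K^+\ne\emptyset$. For nonempty $K\subset\{1,\dots,n\}$ of cardinality $k$, $\nu_K:\{1,\dots,k\}\to\{1,\dots,n\}$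 denotes the unique strictly decreasing function with range $K$ (so $K=\{\nu_K(k)<\cdots<\nu_K(1)\}$). The relation $\vartriangleleft$ is defined by: $J\vartriangleleft I$ if either $I=\emptyset$, or $\#J\ge\#I$ and $\nu_I(\ell)\le\nu_J(\ell)$ for every $1\le\ell\le\#I$. *)

(* Defs.v *)
From HB Require Import structures.
From mathcomp Require Import all_boot all_order all_algebra.
From mathcomp Require Import complex.
From mathcomp Require Import all_classical all_reals all_analysis.

Set Implicit Arguments.
Unset Strict Implicit.
Unset Printing Implicit Defensive.

Import Order.TTheory GRing.Theory Num.Theory.
Import numFieldNormedType.Exports.

Local Open Scope classical_set_scope.
Local Open Scope ring_scope.
Local Open Scope complex_scope.

(* The field of complex numbers, packed so that all its structures are inferred
   as projections of its numClosedFieldType one. *)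
Definition Cplx (R : realType) : numClosedFieldType := R[i].

Definition toC (R : realType) (x : R) : Cplx R := x%:C.

HB.instance Definition _ (R : realType) :=
  GRing.RMorphism.copy (@toC R) (real_complex R).

Lemma toC_lt (R : realType) (x y : R) : (toC x < toC y) = (x < y).
Proof. by rewrite /toC; exact: ltcR. Qed.

Lemma toC_norm (R : realType) (x : R) : `|toC x| = toC `|x|.
Proof. by rewrite /toC [LHS]normc_def /= expr0n /= addr0 sqrtr_sqr. Qed.

Lemma gt0_toC (R : realType) (z : Cplx R) :
  0 < z -> exists2 x : R, 0 < x & z = toC x.
Proof.
by case: z => a b; rewrite [_ < _]ltcE /= => /andP[/eqP-> a0]; exists a.
Qed.

Notation hermitian_product E := {dot E for Num.conj}.

Section HermitianNorm.
Variables (C : numClosedFieldType) (V : vectType C) (h : hermitian_product V).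

Definition hnorm (v : V) : C := sqrtC (h v v).

Lemma hnorm_ge0 v : 0 <= hnorm v.
Proof. exact: sqrt_dnorm_ge0. Qed.

Lemma hnormD_le u v : hnorm (u + v) <= hnorm u + hnorm v.
Proof. by have [] := triangle_lerif h u v. Qed.

Lemma hnormZ a v : hnorm (a *: v) = `|a| * hnorm v.
Proof.
by rewrite /hnorm dnormZ sqrtCM ?nnegrE ?exprn_ge0 ?dnorm_ge0 // sqrCK.
Qed.

End HermitianNorm.

Section Grassmannian.
Variables (C : numClosedFieldType) (V : vectType C) (h : hermitian_product V).

(* All complex subspaces of V, i.e. the disjoint union of the Grassmannians
   Gr_k(V) for k <= dim V.  A set of subspaces is open when, for every k, the
   free k-frames (for the norm of h) spanning one of its members form an open
   set of free k-frames: each Gr_k(V) is open and carries the quotient topology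
   of the manifold of k-frames.  The topology does not depend on h, which is
   only recorded in the type to make the instance below inferable. *)
Definition subspaces of hermitian_product V : Type := {vspace V}.

Definition subspaces_open (U : set (subspaces h)) : Prop :=
  forall (k : nat) (v : k.-tuple V), free v -> U <<v>>%VS ->
    exists2 eps : C, 0 < eps &
      forall w : k.-tuple V, free w ->
        (forall i : 'I_k, hnorm h (w`_i - v`_i) < eps) -> U <<w>>%VS.

HB.instance Definition _ := Choice.copy (subspaces h) {vspace V}.

Lemma subspaces_openT : subspaces_open setT.
Proof. by move=> k v _ _; exists 1. Qed.

Lemma subspaces_openI : setI_closed subspaces_open.
Proof.
move=> A B Aop Bop k v fv [/(Aop _ _ fv)[a a0 Ha] /(Bop _ _ fv)[b b0 Hb]].
have cab : a >=< b by apply: real_comparable; exact: gtr0_real.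
exists (Num.min a b); first by rewrite comparable_lt_min // a0.
move=> w fw Hw; split; [apply: Ha => // i|apply: Hb => // i];
  by have := Hw i; rewrite comparable_lt_min // => /andP[].
Qed.

Lemma subspaces_open_bigU (I : Type) (f : I -> set (subspaces h)) :
  (forall i, subspaces_open (f i)) -> subspaces_open (\bigcup_i f i).
Proof.
move=> fop k v fv [i _ /(fop i _ _ fv)[e e0 He]].
by exists e => // w fw Hw; exists i => //; apply: He.
Qed.

HB.instance Definition _ := isOpenTopological.Build (subspaces h)
  subspaces_openT subspaces_openI subspaces_open_bigU.

End Grassmannian.

Section HermitianSum.
Variables (C : numClosedFieldType) (E : vectType C) (h : hermitian_product E).

Definition hsum (u v : E * E) : C := h u.1 v.1 + h u.2 v.2.

Fact hsum_bilinear :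
  bilinear_for ( *%R : C -> C -> C) (Num.conj \; *%R : C -> C -> C) hsum.
Proof.
split=> [u' | u] a x y; rewrite /hsum /=.
  by rewrite !linearPl /= mulrDr addrACA.
by rewrite !linearPr /= mulrDr addrACA.
Qed.

HB.instance Definition _ :=
  bilinear_isBilinear.Build C (E * E)%type (E * E)%type C
    ( *%R : C -> C -> C) (Num.conj \; *%R : C -> C -> C) hsum hsum_bilinear.

Fact hsum_hermitian u v : hsum u v = (-1) ^+ false * Num.conj (hsum v u).
Proof.
have hC x y : h x y = Num.conj (h y x) by have := hermC h x y; rewrite mul1r.
rewrite mul1r /hsum [h u.1 _]hC [h u.2 _]hC; symmetry; exact: rmorphD.
Qed.

HB.instance Definition _ :=
  isHermitianSesquilinear.Build C (E * E)%type false Num.conj hsum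
    hsum_hermitian.

Fact hsum_gt0 u : u != 0 -> 0 < hsum u u.
Proof.
move=> u0; rewrite lt_def addr_ge0 ?dnorm_ge0 // andbT.
rewrite paddr_eq0 ?dnorm_ge0 // !dnorm_eq0.
by apply: contraNN u0; case: u => a b /= /andP[/eqP-> /eqP->].
Qed.

HB.instance Definition _ := isDotProduct.Build C (E * E)%type hsum hsum_gt0.

End HermitianSum.

Section LagrangianFlow.
Variables (R : realType) (E : vectType (Cplx R)) (h : hermitian_product E).
Variables (n : nat) (e : n.-tuple E).

Local Notation Ehat := (E * E)%type.

Definition J_fun (v : Ehat) : Ehat := (- v.2, v.1).

Fact J_fun_linear : linear J_fun.
Proof.
by move=> a [x y] [z w]; rewrite /J_fun /=; congr pair;
  rewrite /= opprD scalerN.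
Qed.
HB.instance Definition _ := GRing.isLinear.Build (Cplx R) Ehat Ehat _ J_fun
  J_fun_linear.

Definition J : 'End(Ehat) := linfun J_fun.

Definition lagrangian (L : {vspace Ehat}) : Prop :=
  orthov (hsum h) L = (J @: L)%VS.

Definition ehat (i : 'I_n) : Ehat := (e`_i, 0).
Definition fhat (i : 'I_n) : Ehat := (0, e`_i).

Definition Lambda (I : {set 'I_n}) : {vspace Ehat} :=
  <<[seq ehat i | i <- enum I] ++ [seq fhat j | j <- enum (~: I)]>>%VS.

Definition diag_fun (a b : 'I_n -> R) (v : Ehat) : Ehat :=
  (\sum_i (toC (a i) * coord e i v.1) *: e`_i,
   \sum_i (toC (b i) * coord e i v.2) *: e`_i).

Fact diag_fun_linear a b : linear (diag_fun a b).
Proof.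
move=> c x y; rewrite /diag_fun /=; congr pair;
  rewrite /= scaler_sumr -big_split /=; apply: eq_bigr => i _;
  by rewrite linearP /= mulrDr scalerDl scalerA mulrCA.
Qed.
HB.instance Definition _ a b := GRing.isLinear.Build (Cplx R) Ehat Ehat _
  (diag_fun a b) (diag_fun_linear a b).

(* The operator with eigenvectors ehat i, fhat i and eigenvalues a i, b i. *)
Definition diag_op (a b : 'I_n -> R) : 'End(Ehat) := linfun (diag_fun a b).

Definition Ahat (alpha : 'I_n -> R) : 'End(Ehat) :=
  diag_op alpha (fun i => - alpha i).

(* The operator exponential of t Ahat, written in the eigenbasis of Ahat; see
   [exp_AhatE] for its agreement with the exponential series. *)
Definition exp_Ahat (alpha : 'I_n -> R) (t : R) : 'End(Ehat) :=
  diag_op (fun i => expR (t * alpha i)) (fun i => expR (- (t * alpha i))).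

Definition Psi (alpha : 'I_n -> R) (t : R) (L : {vspace Ehat}) :
  {vspace Ehat} := (exp_Ahat alpha t @: L)%VS.

Definition Wplus (alpha : 'I_n -> R) (I : {set 'I_n}) : set {vspace Ehat} :=
  [set L | lagrangian L /\
    (fun t => Psi alpha t L : subspaces (hsum h)) @ +oo
      --> (Lambda I : subspaces (hsum h))].

Definition Wminus (alpha : 'I_n -> R) (I : {set 'I_n}) : set {vspace Ehat} :=
  [set L | lagrangian L /\
    (fun t => Psi alpha (- t) L : subspaces (hsum h)) @ +oo
      --> (Lambda I : subspaces (hsum h))].

Definition prec (alpha : 'I_n -> R) (K M : {set 'I_n}) : Prop :=
  Wminus alpha M `&` Wplus alpha K !=set0.

Hypothesis e_basis : basis_of fullv e.

Lemma diag_op_ehat a b i : diag_op a b (ehat i) = toC (a i) *: ehat i.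
Proof.
have fe := basis_free e_basis.
rewrite lfunE /= /diag_fun /ehat /=; congr pair.
  rewrite (bigD1 i) //= big1 => [|j ji].
    by rewrite coord_free // eqxx mulr1 addr0.
  by rewrite coord_free // eq_sym (negbTE ji) mulr0 scale0r.
by rewrite /= scaler0 big1 // => j _; rewrite linear0 mulr0 scale0r.
Qed.

Lemma diag_op_fhat a b i : diag_op a b (fhat i) = toC (b i) *: fhat i.
Proof.
have fe := basis_free e_basis.
rewrite lfunE /= /diag_fun /fhat /=; congr pair.
  by rewrite /= scaler0 big1 // => j _; rewrite linear0 mulr0 scale0r.
rewrite (bigD1 i) //= big1 => [|j ji].
  by rewrite coord_free // eqxx mulr1 addr0.
by rewrite coord_free // eq_sym (negbTE ji) mulr0 scale0r.
Qed.

Lemma Ahat_ehat alpha i : Ahat alpha (ehat i) = toC (alpha i) *: ehat i.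
Proof. exact: diag_op_ehat. Qed.

Lemma Ahat_fhat alpha i : Ahat alpha (fhat i) = - toC (alpha i) *: fhat i.
Proof. by rewrite [LHS]diag_op_fhat rmorphN. Qed.

End LagrangianFlow.

Section ExponentialSeries.
Variables (R : realType) (E : vectType (Cplx R)) (h : hermitian_product E).
Variables (n : nat) (e : n.-tuple E).
Hypothesis e_basis : basis_of fullv e.

Local Notation Ehat := (E * E)%type.
Local Notation ehat := (ehat e).
Local Notation fhat := (fhat e).

Let vanishes (u : nat -> Ehat) := forall eps : Cplx R, 0 < eps ->
  \forall m \near \oo, hnorm (hsum h) (u m) < eps.

Let vanishesD u v : vanishes u -> vanishes v -> vanishes (fun m => u m + v m).
Proof.
move=> Hu Hv eps e0; have e20 : 0 < eps / 2%:R by rewrite divr_gt0.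
near=> m; apply: le_lt_trans (hnormD_le _ _ _) _.
rewrite [eps]splitr; apply: ltrD; near: m; [exact: Hu|exact: Hv].
Unshelve. all: by end_near. Qed.

Let vanishes_sum (u : 'I_n -> nat -> Ehat) :
  (forall i, vanishes (u i)) -> vanishes (fun m => \sum_i u i m).
Proof.
move=> Hu.
have H (s : seq 'I_n) : vanishes (fun m => \sum_(i <- s) u i m).
  elim: s => [|i s IH].
    move=> eps e0; apply: nearW => m.
    by rewrite big_nil /hnorm linear0l sqrtC0.
  have := vanishesD (Hu i) IH.
  by congr vanishes; apply/funext => m; rewrite big_cons.
exact: H.
Qed.

Let vanishesZ (r : nat -> R) (c : Cplx R) (v : Ehat) :
  r @ \oo --> (0 : R) -> vanishes (fun m => (toC (r m) * c) *: v).
Proof.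
move=> r0 eps e0.
have N0 : 0 <= hnorm (hsum h) (c *: v) by exact: hnorm_ge0.
set d := eps / (hnorm (hsum h) (c *: v) + 1).
have N1 : 0 < hnorm (hsum h) (c *: v) + 1 by rewrite ltr_wpDl.
have d0 : 0 < d by rewrite divr_gt0.
have [a a0 dE] := gt0_toC d0.
near=> m.
rewrite -scalerA hnormZ.
have rm : `|toC (r m)| < d.
  rewrite dE toC_norm toC_lt -[r m]subr0 distrC; near: m.
  by move/cvgrPdist_lt : r0; exact.
apply: (@le_lt_trans _ _ (d * hnorm (hsum h) (c *: v))).
  by rewrite ler_wpM2r // ltW.
rewrite /d mulrAC ltr_pdivrMr // ltr_pM2l // ltrDl.
exact: ltr01.
Unshelve. all: by end_near. Qed.

Lemma exp_AhatE (alpha : 'I_n -> R) (t : R) (v : Ehat) (eps : Cplx R) :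
  0 < eps ->
  \forall m \near \oo,
    hnorm (hsum h) (\sum_(0 <= k < m)
       toC (t ^+ k / k`!%:R) *: iter k (Ahat e alpha) v - exp_Ahat e alpha t v)
      < eps.
Proof.
pose x i := coord e i v.1; pose y i := coord e i v.2.
have vE : v = \sum_i x i *: ehat i + \sum_i y i *: fhat i.
  rewrite [LHS]surjective_pairing.
  rewrite {1}(coord_basis e_basis (memvf v.1)).
  rewrite {1}(coord_basis e_basis (memvf v.2)).
  rewrite [RHS]surjective_pairing /=.
  rewrite !(raddf_sum fst) !(raddf_sum snd) /=.
  rewrite [X in _ = (_ + X, _)]big1 => [|i _]; last by rewrite scaler0.
  rewrite [X in _ = (_, X + _)]big1 => [|i _]; last by rewrite scaler0.
  by rewrite addr0 add0r.
have itE k : iter k (Ahat e alpha) v =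
    \sum_i toC (alpha i ^+ k) * x i *: ehat i +
    \sum_i toC ((- alpha i) ^+ k) * y i *: fhat i.
  elim: k => [|k IH].
    by rewrite /= {1}vE; congr (_ + _); apply: eq_bigr => i _;
      rewrite expr0 mul1r.
  rewrite iterS IH linearD !linear_sum /=; congr (_ + _); apply: eq_bigr => i _.
    by rewrite linearZ /= Ahat_ehat // scalerA exprSr rmorphM mulrAC.
  by rewrite linearZ /= Ahat_fhat // scalerA exprSr rmorphM rmorphN mulrAC.
pose dif (s : R) m : R := \sum_(0 <= k < m) (t ^+ k / k`!%:R) * s ^+ k
   - expR (t * s).
have dif0 s : dif s @ \oo --> (0 : R).
  rewrite -[X in _ --> X](subrr (expR (t * s))).
  apply: cvgB; last exact: cvg_cst.
  have := @is_cvg_series_exp_coeff R (t * s).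
  rewrite -/(expR (t * s)); apply: cvg_trans.
  rewrite (_ : (fun m => _) = series (exp_coeff (t * s))) //.
  apply/funext => m; apply: eq_bigr => k _.
  by rewrite /exp_coeff /= exprMn mulrAC.
have sum_dif s m : toC (dif s m) =
    \sum_(0 <= k < m) toC (t ^+ k / k`!%:R) * toC (s ^+ k) - toC (expR (t * s)).
  by rewrite rmorphB rmorph_sum; congr (_ - _); apply: eq_bigr => k _;
    rewrite rmorphM.
have key m : \sum_(0 <= k < m)
    toC (t ^+ k / k`!%:R) *: iter k (Ahat e alpha) v - exp_Ahat e alpha t v =
    \sum_i (toC (dif (alpha i) m) * x i) *: ehat i +
    \sum_i (toC (dif (- alpha i) m) * y i) *: fhat i.
  rewrite {2}vE linearD !linear_sum /=.
  under eq_bigr do rewrite itE scalerDr !scaler_sumr.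
  rewrite big_split /= opprD addrACA; congr (_ + _);
    rewrite exchange_big /= -sumrB; apply: eq_bigr => i _;
    rewrite linearZ /= ?diag_op_ehat ?diag_op_fhat // sum_dif scalerA ?mulrN;
    rewrite mulrBl scalerBl mulr_suml scaler_suml; congr (_ - _);
    rewrite ?(mulrC (x i)) ?(mulrC (y i)) //;
    by apply: eq_bigr => k _; rewrite scalerA mulrA.
suff : vanishes (fun m => \sum_i (toC (dif (alpha i) m) * x i) *: ehat i +
    \sum_i (toC (dif (- alpha i) m) * y i) *: fhat i).
  move=> H /H; apply: filterS => m; by rewrite key.
by apply: vanishesD; apply: vanishes_sum => i; apply: vanishesZ.
Qed.

End ExponentialSeries.

Section Dominance.
Variable n : nat.
Implicit Types I K : {set 'I_n}.

(* The indices are shifted by one: nu K l is the (l + 1)-st largest element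
   of K, for 0 <= l < #|K|. *)
Definition nu K (l : 'I_#|K|) : 'I_n := enum_val (rev_ord l).

Lemma nu_decreasing K (l m : 'I_#|K|) : (l < m)%N -> (nu m < nu l)%N.
Proof.
move=> lm; have x0 : 'I_n := enum_val l.
have sK : sorted (fun i j : 'I_n => (i < j)%N) (enum K).
  rewrite {1}/enum_mem; apply: sorted_filter; first exact: ltn_trans.
  by rewrite -enumT; have := iota_ltn_sorted 0 n;
    rewrite -val_enum_ord sorted_map.
rewrite /nu !(enum_val_nth x0); apply: (sorted_ltn_nth _ x0 sK).
- exact: ltn_trans.
- by rewrite inE -cardE.
- by rewrite inE -cardE.
- by rewrite /= ltn_sub2l //; exact: leq_ltn_trans lm (ltn_ord m).
Qed.

Lemma nu_range K : (@nu K @: finset.setT)%SET = K.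
Proof.
apply/setP => i; apply/imsetP/idP => [[l _ ->]|iK]; first exact: enum_valP.
by exists (rev_ord (enum_rank_in iK i)); rewrite // /nu rev_ordK enum_rankK_in.
Qed.

Definition dominates K I : Prop :=
  I = finset.set0 \/
  exists le_IK : (#|I| <= #|K|)%N,
    forall l : 'I_#|I|, (nu l <= nu (widen_ord le_IK l))%N.

End Dominance.

(* Main.v *)
(* Order the eigenvectors of the flow by exponent, f_n < ... < f_1 < e_1 < ... < e_n.

   Necessity: if Psi^t L -> Lambda_I, then for large t the projection of Psi^t L
   to Lambda_I along the other coordinates controls the norm up to a factor 2;
   since the flow is diagonal, a vector of L whose projection to Lambda_I grows
   at most like exp(t theta) has all its coordinates of exponent at most theta.
   Applied backwards in time to M this produces, for each m, at least
   #{i in M, i >= m} independent vectors of L in span{e_i, i >= m}; applied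
   forwards to K, the projection to Lambda_K is injective on L, so there are at
   most #{i in K, i >= m} of them.

   Sufficiency: dominance yields an involution s matching each i in M \ K with
   some s i > i in K \ M and fixing all other indices.  Up to signs, L is spanned by
   e_k for k in both sets, f_k for k in neither, e_k + f_k for unmatched k in
   K \ M, and e_i + e_(s i), f_i - f_(s i) for each matched pair. *)
Require Import Defs.
From HB Require Import structures.
From mathcomp Require Import all_boot all_order all_algebra.
From mathcomp Require Import all_classical all_reals all_analysis.
From mathcomp Require Import ring.
From mathcomp Require Import zify.

Set Implicit Arguments.
Unset Strict Implicit.
Unset Printing Implicit Defensive.

Import Order.TTheory GRing.Theory Num.Theory.
Local Open Scope ring_scope.

(** * Combinatorics of dominance: tail counts, matchings and the involution *)

Section Dominance.
Variable n : nat.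
Implicit Types A B K M : {set 'I_n}.

(** Dominance amounts to inequalities between cardinalities of tails, which can be compared with
    dimensions of subspaces and from which common elements cancel. *)
Definition tail A m : {set 'I_n} := [set i in A | (m <= i)%N]%SET.

Lemma nu_inj A : injective (@nu n A).
Proof. by move=> l m /enum_val_inj/rev_ord_inj. Qed.

(** The map sends the l-th largest element of [M] to the l-th largest element of [K]. *)
Lemma dominates_inj K M : dominates K M ->
  exists2 f : 'I_n -> 'I_n, {in M, forall i, f i \in K /\ (i <= f i)%N} &
    {in M &, injective f}.
Proof.
case=> [->|[leMK leN]]; first by exists id => i; rewrite inE.
case: (set_0Vmem M) => [->|[i0 i0M]]; first by exists id => i; rewrite inE.
pose l i := rev_ord (enum_rank_in i0M i).
have nul : {in M, forall i, nu (l i) = i}.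
  by move=> i iM; rewrite /nu rev_ordK enum_rankK_in.
exists (fun i => nu (widen_ord leMK (l i))) => [i iM|i j iM jM].
  split; first exact: enum_valP.
  by rewrite -{1}[i]nul //; exact: leN.
move/nu_inj => ll; rewrite -[i]nul // -[j]nul //; congr nu; apply/val_inj.
exact: (congr1 val ll).
Qed.

Lemma dominates_card K M m : dominates K M -> (#|tail M m| <= #|tail K m|)%N.
Proof.
case/dominates_inj => f fM finj.
rewrite -(@card_in_imset _ _ f) => [|i j]; last first.
  by rewrite !inE => /andP[iM _] /andP[jM _]; exact: finj.
apply/subset_leq_card/fintype.subsetP => _ /imsetP[i + ->]; rewrite !inE.
by case/andP => iM mi; have [-> /(leq_trans mi)->] := fM i iM.
Qed.

(** If dominance fails at [l], the tail of [M] from [nu l] contains its l + 1 largest elements ([nu]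
    counts from 0), while the tail of [K] from there has at most l elements. *)
Lemma card_dominates K M :
  (forall m : 'I_n, #|tail M m| <= #|tail K m|)%N -> dominates K M.
Proof.
move=> D; case: (set_0Vmem M) => [->|[i0 i0M]]; [by left|right].
have leMK : (#|M| <= #|K|)%N.
  (* The tail from index 0 is the whole set; [i0] only witnesses that ['I_n] is inhabited. *)
  have tail0 A : tail A (Ordinal (leq_ltn_trans (leq0n i0) (ltn_ord i0))) = A.
    by apply/setP => i; rewrite !inE andbT.
  by have := D (Ordinal (leq_ltn_trans (leq0n i0) (ltn_ord i0))); rewrite !tail0.
exists leMK => l; rewrite leqNgt; apply/negP => lt.
have := D (nu l); apply/negP; rewrite -ltnNge.
apply: (@leq_trans l.+1).
  rewrite ltnS.
  suff : tail K (nu l) \subset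
      (fun k : 'I_l => nu (widen_ord (leq_trans (ltnW (ltn_ord l)) leMK) k))
        @: [set: 'I_l]%SET.
    move/subset_leq_card/leq_trans; apply; apply: leq_trans (leq_imset_card _ _) _.
    by rewrite cardsT card_ord.
  apply/fintype.subsetP => j; rewrite !inE => /andP[jK lj].
  have := jK; rewrite -{1}(nu_range K) => /imsetP[k _ jE].
  have kl : (k < l)%N.
    rewrite ltnNge; apply/negP => lk.
    have : (nu k <= nu (widen_ord leMK l))%N.
      move: lk; rewrite leq_eqVlt => /orP[/eqP lk|lk].
        by rewrite (_ : k = widen_ord leMK l) //; apply/val_inj.
      by apply/ltnW/nu_decreasing.
    by rewrite -jE; lia.
  apply/imsetP; exists (Ordinal kl); rewrite // jE; congr nu; exact/val_inj.
have -> : l.+1 = #|(fun k : 'I_l.+1 => nu (widen_ord (ltn_ord l) k))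
        @: [set: 'I_l.+1]%SET|.
  rewrite card_imset ?cardsT ?card_ord // => k k' /nu_inj/(congr1 val) /= kk.
  exact/val_inj.
apply/subset_leq_card/fintype.subsetP => _ /imsetP[k _ ->].
rewrite !inE enum_valP /=.
have := ltn_ord k; rewrite ltnS leq_eqVlt => /orP[/eqP kl|kl].
  by rewrite (_ : widen_ord _ k = l) //; apply/val_inj.
by apply/ltnW/nu_decreasing.
Qed.

(** The elements of [K :&: M] contribute equally to both tail counts and cancel. *)
Lemma dominates_setD K M : dominates K M -> dominates (K :\: M) (M :\: K).
Proof.
move=> KM; apply: card_dominates => m; have := dominates_card m KM.
have split A B : (#|tail A m| = #|tail (A :\: B) m| + #|tail (A :&: B) m|)%N.
  rewrite -(cardsID B (tail A m)) addnC; congr (_ + _)%N; apply: eq_card => i;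
  by rewrite !inE; case: (i \in A); case: (i \in B); rewrite ?andbF ?andbT.
by rewrite (split K M) (split M K) (finset.setIC M) leq_add2r.
Qed.

(** The injection from [M :\: K] to [K :\: M] strictly raises indices because the two sets are
    disjoint; the involution exchanges each element with its image. *)
Lemma dominates_involution K M : dominates K M ->
  exists s : 'I_n -> 'I_n,
  [/\ involutive s,
      forall i, (i \in K) = (i \in M) -> s i = i,
      forall i, i \in M :\: K -> s i \in K :\: M /\ (i < s i)%N &
      forall i, i \in K :\: M -> s i = i \/ s i \in M :\: K /\ (s i < i)%N].
Proof.
case/dominates_setD/dominates_inj => f; set A := M :\: K; set B := K :\: M.
move=> fA finj.
have AB i : i \in A -> i \in B = false.
  by rewrite !inE => /andP[/negbTE-> _]; rewrite andbF.
have flt i : i \in A -> (i < f i)%N.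
  move=> iA; have [fB le] := fA i iA; rewrite ltn_neqAle le andbT.
  by apply/eqP => /val_inj E; move: fB; rewrite -E AB.
(* [s] is [f] on [A], the inverse of [f] on the image of [A], and the identity elsewhere. *)
pose s i := if i \in A then f i else
  if [pick j in A | f j == i] is Some j then j else i.
have sA i : i \in A -> s i = f i by rewrite /s => ->.
have sf i : i \in A -> s (f i) = i.
  move=> iA; have [fB _] := fA i iA; rewrite /s ifN; last first.
    by apply/negP => /AB; rewrite fB.
  case: pickP => [j /andP[jA /eqP/finj->]//|/(_ i)].
  by rewrite iA eqxx.
have sC i : i \notin A -> s i = i \/ exists2 j, j \in A & i = f j.
  rewrite /s => /negbTE->; case: pickP => [j /andP[jA /eqP<-]|]; last by left.
  by right; exists j.
exists s; split.
- move=> i; have [iA|/sC[si|[j jA ->]]] := boolP (i \in A).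
  + by rewrite (sA i) // sf.
  + by rewrite !si.
  + by rewrite sf // sA.
- move=> i E; have iA : i \notin A by rewrite inE E; case: (i \in M).
  case: (sC i iA) => // -[j jA ij]; have [+ _] := fA j jA.
  by rewrite -ij inE E; case: (i \in M).
- by move=> i iA; rewrite sA //; have [] := fA i iA; rewrite flt.
- move=> i iB; have iA : i \notin A by apply/negP => /AB; rewrite iB.
  case: (sC i iA) => [|[j jA ->]]; [by left|right].
  by rewrite sf // flt.
Qed.

End Dominance.

(** * Seminorms and open conditions on subspaces *)

Section OpenSetsOfSubspaces.
Variables (C : numClosedFieldType) (V : vectType C) (h : hermitian_product V).
Local Notation N := (hnorm h).

Lemma hnorm_eq0 v : (N v == 0) = (v == 0).
Proof. exact: sqrt_dnorm_eq0. Qed.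

Lemma hnorm0 : N 0 = 0.
Proof. by apply/eqP; rewrite hnorm_eq0. Qed.

Lemma hform_le u v : `|h u v| <= N u * N v.
Proof. by have [] := CauchySchwarz_sqrt h u v. Qed.

Lemma form_sum_dual (I : finType) (b : I -> V) (k : I -> C) j :
  (forall i j, h (b i) (b j) = (i == j)%:R) -> h (\sum_i k i *: b i) (b j) = k j.
Proof.
move=> hb; rewrite linear_sumlz (bigD1 j) //= linearZl_LR /= hb eqxx mulr1.
rewrite -[RHS]addr0; congr (_ + _).
by apply: big1 => i ij; rewrite linearZl_LR /= hb (negbTE ij) mulr0.
Qed.

(** Pairing a vanishing combination with [y j] isolates its j-th coefficient. *)
Lemma free_dual k (x y : 'I_k -> V) :
  (forall i j, i != j -> h (x i) (y j) = 0) -> (forall i, h (x i) (y i) != 0) ->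
  free [tuple x i | i < k].
Proof.
move=> xy0 xy1; apply/freeP => c c0 j.
have {c0} : \sum_i c i *: x i = 0.
  by rewrite -[RHS]c0; apply: eq_bigr => i _; rewrite -tnth_nth tnth_mktuple.
move/(congr1 (fun v => h v (y j))); rewrite linear0l.
have -> : h (\sum_i c i *: x i) (y j) = c j * h (x j) (y j).
  rewrite linear_sumlz (bigD1 j) //= linearZl_LR -[RHS]addr0; congr (_ + _).
  by apply: big1 => i ij; rewrite linearZl_LR /= xy0 ?mulr0.
by move/eqP; rewrite mulf_eq0 (negbTE (xy1 j)) orbF => /eqP.
Qed.

Definition seminorm (g : V -> C) : Prop :=
  (forall u v, g (u + v) <= g u + g v) /\ (forall a v, g (a *: v) = `|a| * g v).

Lemma seminorm_hnorm : seminorm N.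
Proof. by split; [exact: hnormD_le|exact: hnormZ]. Qed.

Lemma seminorm0 g : seminorm g -> g 0 = 0.
Proof. by case=> _ gZ; rewrite -(scale0r 0) gZ normr0 mul0r. Qed.

Lemma seminormN g v : seminorm g -> g (- v) = g v.
Proof. by case=> _ gZ; rewrite -scaleN1r gZ normrN1 mul1r. Qed.

(** The triangle inequality for [v] and [- v] gives 0 <= 2 g(v). *)
Lemma seminorm_ge0 g v : seminorm g -> 0 <= g v.
Proof.
move=> sg; have : g (v + - v) <= g v + g (- v) by case: sg.
by rewrite subrr seminorm0 // seminormN // -mulr2n -mulr_natl pmulr_rge0.
Qed.

Lemma seminorm_sum g (I : finType) (F : I -> V) : seminorm g ->
  g (\sum_i F i) <= \sum_i g (F i).
Proof.
move=> sg; elim/big_rec2: _ => [|i y x _ le]; first by rewrite seminorm0.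
by have [gD _] := sg; apply: le_trans (gD _ _) _; rewrite lerD2l.
Qed.

Lemma seminorm_comp g (f : {linear V -> V}) : seminorm g -> seminorm (g \o f).
Proof.
case=> gD gZ; split=> [u v|a v] /=; first by rewrite linearD; exact: gD.
by rewrite linearZ; exact: gZ.
Qed.

Lemma seminorm_coord k (v : k.-tuple V) :
  seminorm (fun x => \sum_i `|coord v i x|).
Proof.
split=> [x y|a x]; rewrite ?mulr_sumr -?big_split.
  by apply: ler_sum => i _; rewrite linearD ler_normD.
by apply: eq_bigr => i _; rewrite linearZ normrM.
Qed.

Variables (T : finType) (b : T -> V).
Hypothesis fourier : forall x, x = \sum_t h x (b t) *: b t.

(** Expand in the finite family [b] and bound each coefficient by Cauchy-Schwarz; the added 1 makes
    the constant positive. *)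
Lemma seminorm_bounded g : seminorm g ->
  exists2 B, 0 < B & forall x, g x <= B * N x.
Proof.
move=> sg; have [gD gZ] := sg; exists (1 + \sum_t N (b t) * g (b t)).
  by rewrite ltr_wpDr // sumr_ge0 // => t _; rewrite mulr_ge0 ?hnorm_ge0 ?seminorm_ge0.
move=> x; rewrite {1}[x]fourier; apply: le_trans (seminorm_sum _ sg) _.
rewrite mulrDl mul1r; apply: ler_wpDl; first exact: hnorm_ge0.
rewrite mulr_suml; apply: ler_sum => t _; rewrite gZ mulrAC.
by rewrite ler_wpM2r ?seminorm_ge0 // mulrC hform_le.
Qed.

Lemma open_dim k : subspaces_open [set W : subspaces h | \dim W = k]%classic.
Proof.
move=> m v fv; rewrite /mkset (eqP fv) => <-.
by exists 1 => // w /eqP fw _; rewrite /mkset fw !size_tuple.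
Qed.

(** The strict inequality between [c0] and [c] leaves room to lower [c] to their midpoint when the
    frame is perturbed. *)
Lemma open_lower g (c0 : C) : seminorm g -> 0 <= c0 ->
  subspaces_open [set W : subspaces h |
    exists2 c, c0 < c & forall x, x \in W -> c * N x <= g x]%classic.
Proof.
move=> sg c00 k v fv [c c0c cP].
have [B B0 gB] := seminorm_bounded sg.
have [A A0 cA] := seminorm_bounded (seminorm_coord v).
pose c' := (c0 + c) / 2%:R.
have c0c' : c0 < c' by have [] := midf_lt c0c.
have c'c : c' < c by have [] := midf_lt c0c.
(* Chosen so that the loss [A * eps * (c' + B)] from the perturbation is exactly [c - c']. *)
pose eps := (c - c') / (A * (c' + B)).
have D0 : 0 < A * (c' + B).
  by rewrite mulr_gt0 // addr_gt0 // (le_lt_trans c00).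
have eps0 : 0 < eps by rewrite divr_gt0 // subr_gt0.
have e1 : A * eps * (c' + B) = c - c'.
  by rewrite mulrAC /eps mulrCA divff ?mulr1 // gt_eqF.
clearbody c' eps; exists eps => // w fw wv; exists c' => // x' /coord_span x'E.
(* [x] has the same coordinates in the frame [v] as [x'] has in [w]; the bound on coordinates makes
   [x' - x] small relative to [x]. *)
pose x := \sum_i coord w i x' *: v`_i.
have cx i : coord v i x = coord w i x' by exact: coord_sum_free.
have xx' : N (x' - x) <= A * eps * N x.
  rewrite {1}x'E -sumrB; apply: le_trans (seminorm_sum _ seminorm_hnorm) _.
  apply: (@le_trans _ _ (eps * \sum_i `|coord v i x|)); last first.
    by rewrite [A * eps]mulrC -mulrA ler_wpM2l // ltW.
  rewrite mulr_sumr; apply: ler_sum => i _.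
  by rewrite -scalerBr hnormZ cx mulrC ler_wpM2r // ltW.
have xW : c * N x <= g x.
  by apply: cP; apply: memv_suml => i _; rewrite memvZ // memv_span // mem_nth // size_tuple.
have Nx' : N x' <= N x + N (x' - x).
  by rewrite -{1}[x'](subrK x) addrC hnormD_le.
have gx' : g x <= g x' + g (x' - x).
  by rewrite -{1}[x](subKr x') -(seminormN (x' - x) sg); case: sg.
have c'0 : 0 <= c' by apply: ltW; exact: le_lt_trans c0c'.
apply: (@le_trans _ _ (c' * (N x + A * eps * N x))).
  by rewrite ler_wpM2l // (le_trans Nx') // lerD2l.
rewrite -(lerD2r (g (x' - x))); apply: le_trans gx'; apply: le_trans xW.
apply: (@le_trans _ _ (c' * (N x + A * eps * N x) + B * (A * eps * N x))).
  by rewrite lerD2l (le_trans (gB _)) // ler_wpM2l // ltW.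
rewrite le_eqVlt; apply/orP; left; apply/eqP.
have -> : c = A * eps * (c' + B) + c' by rewrite e1 subrK.
ring.
Qed.

End OpenSetsOfSubspaces.

Lemma toC_le (R : realType) (x y : R) : (toC x <= toC y) = (x <= y).
Proof. by rewrite !le_eqVlt toC_lt (inj_eq (fmorph_inj _)). Qed.

Lemma norm_toC_expR (R : realType) (x : R) : `|toC (expR x)| = toC (expR x).
Proof. by rewrite toC_norm ger0_norm ?expR_ge0. Qed.

(** * Orthonormal coordinates on the doubled space and diagonal operators *)

Section CoordinateFlow.
Variables (R : realType) (E : vectType (Cplx R)) (h : hermitian_product E).
Variables (n : nat) (e : n.-tuple E).
Hypotheses (e_basis : basis_of fullv e) (e_orthonormal : orthonormal h e).

Local Notation Ehat := (E * E)%type.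
Local Notation H := (hsum h).
Local Notation N := (hnorm (hsum h)).
Local Notation idx := (bool * 'I_n)%type.

Definition bvec (p : idx) : Ehat := if p.1 then ehat e p.2 else fhat e p.2.

Definition lam (alpha : 'I_n -> R) (p : idx) : R :=
  if p.1 then alpha p.2 else - alpha p.2.

Lemma form_basis (i j : 'I_n) : h e`_i e`_j = (i == j)%:R.
Proof.
have [ue eP] := orthonormalP e_orthonormal.
have -> : (i == j) = (e`_i == e`_j).
  by rewrite nth_uniq ?size_tuple.
by rewrite eP ?mem_nth ?size_tuple.
Qed.

Lemma form_coord x (i : 'I_n) : h x e`_i = coord e i x.
Proof.
rewrite {1}(coord_basis e_basis (memvf x)).
exact: (form_sum_dual (b := fun i : 'I_n => e`_i) _ _ form_basis).
Qed.

Lemma hsum_bvec p q : H (bvec p) (bvec q) = (p == q)%:R.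
Proof.
case: p q => c i [d j]; rewrite /hsum /bvec /ehat /fhat xpair_eqE.
by case: c; case: d => /=; rewrite ?form_basis ?linear0l ?linear0r ?addr0 ?add0r.
Qed.

Lemma hsum_fourier (x : Ehat) : x = \sum_p H x (bvec p) *: bvec p.
Proof.
have -> : \sum_p H x (bvec p) *: bvec p =
    \sum_(c : bool) \sum_i H x (bvec (c, i)) *: bvec (c, i).
  by rewrite pair_bigA; apply: eq_bigr => -[].
rewrite big_bool /= /bvec /= [LHS]surjective_pairing.
rewrite {1}(coord_basis e_basis (memvf x.1)).
rewrite {1}(coord_basis e_basis (memvf x.2)).
rewrite [RHS]surjective_pairing /= !(raddf_sum fst) !(raddf_sum snd) /=.
rewrite [X in _ = (_ + X, _)]big1 => [|i _]; last by rewrite scaler0.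
rewrite [X in _ = (_, X + _)]big1 => [|i _]; last by rewrite scaler0.
rewrite addr0 add0r; congr (_, _); apply: eq_bigr => i _; congr (_ *: _);
  by rewrite /hsum /= linear0r ?addr0 ?add0r form_coord.
Qed.

Lemma hnorm_bvec p : N (bvec p) = 1.
Proof. by rewrite /hnorm [X in sqrtC X](hsum_bvec p p) eqxx sqrtC1. Qed.

Lemma bvec_ext x y : (forall p, H x (bvec p) = H y (bvec p)) -> x = y.
Proof.
by move=> xy; rewrite [x]hsum_fourier [y]hsum_fourier; apply: eq_bigr => p _; rewrite xy.
Qed.

Lemma hsum_sum (k : idx -> Cplx R) q : H (\sum_p k p *: bvec p) (bvec q) = k q.
Proof. exact: form_sum_dual hsum_bvec. Qed.

Lemma bvec_inj : injective bvec.
Proof.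
move=> p q pq; apply/eqP; have := hsum_bvec p q; rewrite pq hsum_bvec eqxx.
by case: eqP => // _ /eqP; rewrite oner_eq0.
Qed.

Definition cspan (P : {set idx}) : {vspace Ehat} := <<[seq bvec p | p <- enum P]>>%VS.

Lemma orthonormal_bvec (s : seq idx) : uniq s -> orthonormal H (map bvec s).
Proof.
move=> us; apply/orthonormalP; split; first by rewrite (map_inj_uniq bvec_inj).
move=> _ _ /mapP[p _ ->] /mapP[q _ ->].
by rewrite [LHS]hsum_bvec (inj_eq bvec_inj).
Qed.

Lemma dim_cspan (P : {set idx}) : \dim (cspan P) = #|P|.
Proof.
have /orthonormal_free/eqP-> := orthonormal_bvec (enum_uniq P).
by rewrite size_map -cardE.
Qed.

Lemma cspanP (P : {set idx}) x :
  reflect (forall p, H x (bvec p) != 0 -> p \in P) (x \in cspan P).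
Proof.
apply: (iffP idP) => [xP q|xP].
  apply: contraNT => qP.
  have : (cspan P <= orthov H <[bvec q]>)%VS.
    apply/span_subvP => _ /mapP[p pP ->]; rewrite mem_orthov1 [X in X == 0]hsum_bvec.
    rewrite pnatr_eq0 eqb0; apply: contraNneq qP => <-.
    by rewrite -mem_enum.
  by move/subvP => /(_ _ xP); rewrite mem_orthov1.
rewrite [x]hsum_fourier; apply: memv_suml => p _.
have [->|/xP pP] := eqVneq (H x (bvec p)) 0; first by rewrite scale0r mem0v.
by rewrite memvZ // memv_span // map_f // mem_enum.
Qed.

Lemma dim_Ehat : \dim (fullv : {vspace Ehat}) = (n + n)%N.
Proof.
have -> : fullv = cspan finset.setT.
  apply/eqP; rewrite eqEsubv subvf andbT; apply/subvP => x _.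
  by apply/cspanP => p _; rewrite inE.
by rewrite dim_cspan cardsT card_prod card_bool card_ord mul2n addnn.
Qed.

(** Over each i exactly one index is kept: that of e_i if i is in [I], that of f_i otherwise. *)
Definition Lidx (I : {set 'I_n}) : {set idx} := [set p | p.1 == (p.2 \in I)]%SET.

Lemma card_Lidx I : #|Lidx I| = n.
Proof.
rewrite -[RHS]card_ord -[RHS]cardsT.
rewrite -(card_imset finset.setT (f := fun i => (i \in I, i))) => [|i j [] //].
apply: eq_card => -[c i]; rewrite inE; apply/eqP/imsetP => /= [->|[j _ [-> ->]] //].
by exists i; rewrite ?inE.
Qed.

Lemma LambdaE I : Lambda e I = cspan (Lidx I).
Proof.
apply: eq_span => x; rewrite mem_cat; apply/orP/mapP.
  case=> /mapP[i]; rewrite mem_enum => iI ->; [exists (true, i)|exists (false, i)] => //;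
  by move: iI; rewrite mem_enum !inE; case: (i \in I).
case=> -[c i]; rewrite mem_enum inE => /= /eqP-> ->; rewrite /bvec /=.
by case: ifP => iI; [left|right]; apply: map_f; rewrite mem_enum ?inE iI.
Qed.

(** Both the flow and the coordinate projections have this form, so they commute and act on each
    coefficient separately. *)
Definition dop (w : idx -> R) : 'End(Ehat) :=
  diag_op e (fun i => w (true, i)) (fun i => w (false, i)).

Lemma dop_bvec w p : dop w (bvec p) = toC (w p) *: bvec p.
Proof.
by case: p => -[] i; rewrite /dop /bvec /= ?diag_op_ehat ?diag_op_fhat.
Qed.

Lemma hsum_dop w x p : H (dop w x) (bvec p) = toC (w p) * H x (bvec p).
Proof.
rewrite {1}[x]hsum_fourier linear_sum /=.
under eq_bigr do rewrite linearZ /= dop_bvec scalerA.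
by rewrite hsum_sum mulrC.
Qed.

Lemma dopC w w' x : dop w (dop w' x) = dop w' (dop w x).
Proof. by apply: bvec_ext => p; rewrite !hsum_dop mulrCA. Qed.

Lemma dop_eq0 w x : (forall p, w p != 0) -> dop w x = 0 -> x = 0.
Proof.
move=> w0 wx; apply: bvec_ext => p; rewrite linear0l; apply/eqP.
have /eqP := hsum_dop w x p.
by rewrite wx linear0l eq_sym mulf_eq0 fmorph_eq0 (negbTE (w0 p)).
Qed.

Lemma exp_AhatE_dop alpha t : exp_Ahat e alpha t = dop (fun p => expR (t * lam alpha p)).
Proof.
by rewrite /exp_Ahat /dop /lam /=; congr (diag_op e _ _); apply/funext => i; rewrite mulrN.
Qed.

(** Lets the limit lemmas as t tends to +oo, stated for arbitrary real [alpha], be applied to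
    [Wminus] as well. *)
Lemma exp_AhatN alpha t : exp_Ahat e alpha (- t) = exp_Ahat e (fun i => - alpha i) t.
Proof.
rewrite !exp_AhatE_dop; congr (dop _); apply/funext => p.
by rewrite /lam mulNr; case: p.1; rewrite !mulrN.
Qed.

Lemma exp_Ahat_eq0 alpha t x : exp_Ahat e alpha t x = 0 -> x = 0.
Proof. by rewrite exp_AhatE_dop; apply: dop_eq0 => p; rewrite gt_eqF ?expR_gt0. Qed.

Lemma dim_Psi alpha t L : \dim (Psi e alpha t L) = \dim L.
Proof.
apply: limg_dim_eq; apply/eqP; rewrite -subv0; apply/subvP => x.
by rewrite memv_cap memv_ker memv0 => /andP[_ /eqP/exp_Ahat_eq0->].
Qed.

Definition proj (I : {set 'I_n}) : 'End(Ehat) := dop (fun p => (p \in Lidx I)%:R).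

Lemma hsum_proj I x p : H (proj I x) (bvec p) = (p \in Lidx I)%:R * H x (bvec p).
Proof. by rewrite hsum_dop rmorph_nat. Qed.

Lemma proj_id I x : x \in cspan (Lidx I) -> proj I x = x.
Proof.
move/cspanP => xI; apply: bvec_ext => p; rewrite hsum_proj.
have [->|/xI->] := eqVneq (H x (bvec p)) 0; by rewrite ?mulr0 ?mul1r.
Qed.

Lemma proj_in I x : proj I x \in cspan (Lidx I).
Proof.
by apply/cspanP => p; rewrite hsum_proj; case: (p \in Lidx I); rewrite ?mul0r ?eqxx.
Qed.


(** * Consequences of convergence to a coordinate Lagrangian *)

Lemma seminorm_proj I : seminorm (fun x => N (proj I x)).
Proof. exact: (seminorm_comp (proj I) (seminorm_hnorm _)). Qed.

(** Having dimension n, and the bound [c * N x <= N (proj I x)] with some c > 1/2, are open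
    conditions. [Lambda e I] satisfies them with c = 1, so the flowed subspace eventually does
    too. *)
Lemma cvg_Psi_lower alpha I L :
  ((fun t => Psi e alpha t L : subspaces (hsum h)) @ +oo
      --> (Lambda e I : subspaces (hsum h)))%classic ->
  \dim L = n /\
  \forall t \near +oo, forall x, x \in L ->
    N (exp_Ahat e alpha t x) <= 2 * N (proj I (exp_Ahat e alpha t x)).
Proof.
move=> cvgL.
have near_open (U : set (subspaces (hsum h))) : subspaces_open U -> U (Lambda e I) ->
    \forall t \near +oo, U (Psi e alpha t L).
  by move=> oU UI; apply: cvgL; apply: open_nbhs_nbhs.
split.
  have := near_open _ (@open_dim _ _ _ n).
  rewrite /mkset {1}LambdaE dim_cspan card_Lidx => /(_ erefl)/filter_ex[t].
  by rewrite dim_Psi.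
have half0 : 0 <= 2^-1 :> Cplx R by rewrite invr_ge0.
move: (near_open _ (open_lower hsum_fourier (seminorm_proj I) half0)).
rewrite /mkset => nearI; have /nearI : exists2 c : Cplx R, 2^-1 < c &
    forall x, x \in Lambda e I -> c * N x <= N (proj I x).
  exists 1; first by rewrite invf_lt1 ?ltr1n.
  by move=> x; rewrite LambdaE mul1r => /proj_id->.
apply: filterS => t [c c2 cP] x xL.
have := cP (exp_Ahat e alpha t x) (memv_img _ xL).
move=> le; rewrite mulrC -ler_pdivrMr // mulrC; apply: le_trans le.
by rewrite ler_wpM2r ?hnorm_ge0 // ltW.
Qed.

(** The projection commutes with the flow, so it also kills the flowed vector, whose norm is at most
    twice that of its projection. *)
Lemma cvg_Psi_inj alpha I L :
  ((fun t => Psi e alpha t L : subspaces (hsum h)) @ +oo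
      --> (Lambda e I : subspaces (hsum h)))%classic ->
  forall x, x \in L -> proj I x = 0 -> x = 0.
Proof.
move=> /cvg_Psi_lower[_ /filter_ex[t lowP]] x xL px0.
have := lowP x xL; rewrite exp_AhatE_dop /proj dopC -/(proj I x) px0 linear0.
rewrite hnorm0 mulr0 => le0; have /eqP : N (exp_Ahat e alpha t x) = 0.
  by apply: le_anti; rewrite hnorm_ge0 andbT exp_AhatE_dop.
by rewrite hnorm_eq0 => /eqP/exp_Ahat_eq0.
Qed.

Lemma expR_eventually_large (d : R) (b : Cplx R) : 0 < d -> 0 <= b ->
  \forall t \near +oo, b < toC (expR (t * d)).
Proof.
(* Adding 1 makes the complex number [b] strictly positive, hence the image of a positive real
   [a]. *)
move=> d0 b0; have [a a0 aE] : exists2 a : R, 0 < a & 1 + b = toC a.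
  by apply: gt0_toC; rewrite ltr_wpDr.
exists (a / d); split; first exact: num_real.
move=> t /=; rewrite ltr_pdivrMr // => lt.
apply: (@lt_trans _ _ (1 + b)); first by rewrite ltrDr.
rewrite aE toC_lt; apply: (lt_le_trans lt); apply: le_trans (expR_ge1Dx _).
by rewrite lerDr.
Qed.

(** Coordinate [p] of the flowed vector has modulus exp(t lam p) r, while the whole vector has norm
    at most 2 exp(t theta) S; for large t this forces lam p <= theta. *)
Lemma cvg_Psi_growth alpha I L theta x :
  ((fun t => Psi e alpha t L : subspaces (hsum h)) @ +oo
      --> (Lambda e I : subspaces (hsum h)))%classic ->
  x \in L ->
  (forall p, H (proj I x) (bvec p) != 0 -> lam alpha p <= theta) ->
  forall p, H x (bvec p) != 0 -> lam alpha p <= theta.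
Proof.
move=> /cvg_Psi_lower[_ lowP] xL projP p xp; rewrite leNgt; apply/negP => lt.
set r := `|H x (bvec p)|; have r0 : 0 < r by rewrite normr_gt0.
set S := \sum_q `|H (proj I x) (bvec q)|.
have S0 : 0 <= S by rewrite sumr_ge0.
have d0 : 0 < lam alpha p - theta by rewrite subr_gt0.
have b0 : 0 <= 2 * S / r by rewrite divr_ge0 // ?mulr_ge0 // ltW.
(* [t] is taken so large that exp(t (lam p - theta)) exceeds 2 S / r, and positive so that exponents
   compare as rates do. *)
have [t [[/(_ x xL) low large] t0]] := filter_ex (filterI
  (filterI lowP (expR_eventually_large d0 b0)) (nbhs_pinfty_gt (num_real (0 : R)))).
have up : N (proj I (exp_Ahat e alpha t x)) <= toC (expR (t * theta)) * S.
  rewrite exp_AhatE_dop /proj dopC -/(proj I x) [X in N X]hsum_fourier.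
  apply: le_trans (seminorm_sum _ (seminorm_hnorm _)) _.
  rewrite mulr_sumr; apply: ler_sum => q _.
  rewrite hnormZ hnorm_bvec mulr1 hsum_dop normrM.
  have [->|q0] := eqVneq (H (proj I x) (bvec q)) 0; first by rewrite normr0 !mulr0.
  rewrite ler_wpM2r // norm_toC_expR.
  rewrite toC_le ler_expR ler_pM2l //; exact: projP.
have : toC (expR (t * lam alpha p)) * r <= 2 * (toC (expR (t * theta)) * S).
  apply: le_trans (le_trans low _); last by rewrite ler_pM2l.
  apply: le_trans (_ : `|H (exp_Ahat e alpha t x) (bvec p)| <= _).
    by rewrite exp_AhatE_dop hsum_dop normrM norm_toC_expR.
  by apply: le_trans (hform_le _ _ _) _; rewrite hnorm_bvec mulr1.
have a0 : 0 < toC (expR (t * theta)) by rewrite -(rmorph0 (@toC R)) toC_lt expR_gt0.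
have aE : toC (expR (t * theta)) * toC (expR (t * (lam alpha p - theta))) =
    toC (expR (t * lam alpha p)).
  by rewrite -rmorphM -expRD -mulrDr addrC subrK.
move: large; rewrite ltr_pdivrMr // -(ltr_pM2l a0) [X in _ < X]mulrA aE mulrCA => lt' le'.
by have := lt_le_trans lt' le'; rewrite ltxx.
Qed.

(** * Necessity: comparing tail counts through dimensions *)

Lemma dim_limg_le (f : 'End(Ehat)) (V : {vspace Ehat}) : (\dim (f @: V) <= \dim V)%N.
Proof. by rewrite -(limg_ker_dim f V) leq_addl. Qed.

Lemma prec_card alpha K M (m : 'I_n) :
  (forall i j : 'I_n, (i < j)%N -> alpha i < alpha j) ->
  (forall i, 0 < alpha i) ->
  prec h e alpha K M -> (#|tail M m| <= #|tail K m|)%N.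
Proof.
move=> alpha_lt alpha_gt0 [L [[_ LM] [_ LK]]].
have {}LM : ((fun t => Psi e (fun i => - alpha i) t L : subspaces (hsum h)) @ +oo
    --> (Lambda e M : subspaces (hsum h)))%classic.
  by move: LM; rewrite /Psi; under eq_fun do rewrite exp_AhatN.
pose T A := [set p : idx | p.1 && (p.2 \in tail A m)]%SET.
have cardT A : #|T A| = #|tail A m|.
  rewrite -[RHS](card_imset _ (f := fun i => (true, i))) => [|i j [] //].
  apply: eq_card => -[c i]; rewrite inE /=; apply/andP/imsetP => [[-> iA]|[j jA [-> ->]] //].
  by exists i.
have TL A : T A \subset Lidx A.
  apply/fintype.subsetP => -[c i]; rewrite !inE /= => /andP[-> /andP[-> _]].
  by [].
have [dimL _] := cvg_Psi_lower LM.
(* The projection is injective on [L], and [L] has the dimension n of the target, so it is onto. *)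
have pL : (proj M @: L)%VS = cspan (Lidx M).
  apply/eqP; rewrite eqEdim dim_cspan card_Lidx; apply/andP; split.
    by apply/subvP => _ /memv_imgP[x _ ->]; exact: proj_in.
  rewrite limg_dim_eq ?dimL //; apply/eqP; rewrite -subv0; apply/subvP => x.
  rewrite memv_cap memv_ker memv0 => /andP[xL /eqP px].
  by rewrite (cvg_Psi_inj LM xL px).
(* Vectors of [L] whose projection to [Lambda e M] involves only e_i with i >= m; by surjectivity
   they form a space of dimension at least the tail count of [M]. *)
pose V := (L :&: (proj M @^-1: cspan (T M)))%VS.
rewrite -!cardT -!dim_cspan.
have dimV : (\dim (cspan (T M)) <= \dim V)%N.
  apply: leq_trans (dim_limg_le (proj M) V); apply: dimvS; apply/subvP => y yT.
  have : y \in (proj M @: L)%VS.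
    by rewrite pL; apply/cspanP => p /(cspanP _ _ yT); exact: (fintype.subsetP (TL M)).
  case/memv_imgP => x xL yE; rewrite yE memv_img // memv_cap xL -memv_preim.
  by rewrite -yE.
apply: leq_trans dimV _.
have <- : \dim (proj K @: V) = \dim V.
  apply: limg_dim_eq; apply/eqP; rewrite -subv0; apply/subvP => x.
  rewrite !memv_cap memv_ker memv0 => /andP[/andP[xL _] /eqP px].
  by rewrite (cvg_Psi_inj LK xL px).
apply: dimvS; apply/subvP => _ /memv_imgP[x + ->].
rewrite memv_cap -memv_preim => /andP[xL /cspanP xT].
(* Backwards in time e_i has exponent [- alpha i] and f_i has [alpha i]. The bound [- alpha m]
   therefore retains only e_i with i >= m and excludes every f_i. *)
have grow := cvg_Psi_growth (theta := - alpha m) LM xL.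
have {}grow : forall p, H x (bvec p) != 0 -> lam (fun i => - alpha i) p <= - alpha m.
  apply: grow => p /xT; rewrite !inE /lam => /andP[-> /andP[_ mp]].
  rewrite lerN2; move: mp; rewrite leq_eqVlt => /orP[/eqP/val_inj->//|/alpha_lt/ltW//].
apply/cspanP => -[c i]; rewrite hsum_proj !inE /=.
have [->|_] := eqVneq c (i \in K); last by rewrite mul0r eqxx.
rewrite mul1r => /grow; rewrite /lam /=.
case: (i \in K) => /=.
  by rewrite lerN2 leqNgt; apply: contraTN => /alpha_lt; rewrite ltNge.
by rewrite opprK leNgt (lt_trans _ (alpha_gt0 i)) // oppr_lt0.
Qed.

(** * Limits of spans of explicit frames, and a criterion for Lagrangian subspaces *)

Definition fam k (x : 'I_k -> Ehat) : k.-tuple Ehat := [tuple x i | i < k].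

Lemma nth_fam k (x : 'I_k -> Ehat) (i : 'I_k) : (fam x)`_i = x i.
Proof. by rewrite -tnth_nth tnth_mktuple. Qed.

Lemma mem_fam k (x : 'I_k -> Ehat) i : x i \in <<fam x>>%VS.
Proof. by rewrite -nth_fam memv_span // mem_nth // size_tuple. Qed.

Lemma fam_sub k (x : 'I_k -> Ehat) (U : {vspace Ehat}) :
  (forall i, x i \in U) -> (<<fam x>> <= U)%VS.
Proof. by move=> xU; apply/span_subvP => _ /mapP[i _ ->]; exact: xU. Qed.

Lemma span_fam_scale k (c : 'I_k -> Cplx R) (x : 'I_k -> Ehat) :
  (forall i, c i != 0) -> <<fam (fun i => c i *: x i)%R>>%VS = <<fam x>>%VS.
Proof.
move=> c0; apply/eqP; rewrite eqEsubv; apply/andP; split; apply: fam_sub => i.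
  by rewrite memvZ // mem_fam.
by rewrite -[x i](scalerK (c0 i)) memvZ // (mem_fam (fun i => c i *: x i)).
Qed.

Lemma limg_fam k (f : 'End(Ehat)) (x : 'I_k -> Ehat) :
  (f @: <<fam x>>)%VS = <<fam (fun i => f (x i))>>%VS.
Proof. by rewrite limg_span /fam -map_comp. Qed.

(** Dividing the i-th flowed vector by exp(t la i) keeps the span and turns it into p_i + exp(t (mu
    i - la i)) r_i, which tends to p_i. *)
Lemma cvg_Psi_frame alpha k (p r : 'I_k -> Ehat) (la mu : 'I_k -> R) :
  (forall t i, exp_Ahat e alpha t (p i) = toC (expR (t * la i)) *: p i) ->
  (forall t i, exp_Ahat e alpha t (r i) = toC (expR (t * mu i)) *: r i) ->
  (forall i, mu i < la i) ->
  free (fam p) -> free (fam (fun i => p i + r i)) ->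
  ((fun t => Psi e alpha t <<fam (fun i => p i + r i)%R>>%VS : subspaces (hsum h)) @ +oo
      --> (<<fam p>>%VS : subspaces (hsum h)))%classic.
Proof.
move=> expp expr mula fp fx A; rewrite nbhsE => -[B [oB Bp] /filterS]; apply.
have [eps eps0 BP] := oB k _ fp Bp.
pose w t i := p i + toC (expR (t * (mu i - la i))) *: r i.
have PsiE t : Psi e alpha t <<fam (fun i => p i + r i)%R>>%VS = <<fam (w t)>>%VS.
  rewrite /Psi limg_fam.
  have c0 i : toC (expR (t * la i)) != 0 by rewrite fmorph_eq0 gt_eqF ?expR_gt0.
  rewrite -(span_fam_scale (w t) c0); congr (<<fam _>>%VS); apply/funext => i.
  rewrite linearD /= expp expr /w scalerDr scalerA -rmorphM -expRD.
  by rewrite -mulrDr [la i + _]addrC subrK.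
have small i : \forall t \near +oo, toC (expR (t * (mu i - la i))) * N (r i) < eps.
  have d0 : 0 < la i - mu i by rewrite subr_gt0.
  have b0 : 0 <= N (r i) / eps by rewrite divr_ge0 ?hnorm_ge0 // ltW.
  apply: filterS (expR_eventually_large d0 b0) => t.
  rewrite ltr_pdivrMr // -[mu i - la i]opprB mulrN expRN fmorphV => lt.
  rewrite mulrC ltr_pdivrMr 1?mulrC //.
  by rewrite -(rmorph0 (@toC R)) toC_lt expR_gt0.
have {}small := filter_forall _ small.
suff : \forall t \near +oo, B (Psi e alpha t <<fam (fun i => p i + r i)%R>>%VS) by [].
case: small => T [Tr TP]; exists T; split=> // t /TP lt; rewrite PsiE; apply: BP => [|i].
  (* The rescaled frame is free because the flow preserves the dimension of the span. *)
  have := dim_Psi alpha t <<fam (fun i => p i + r i)%R>>%VS.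
  by rewrite PsiE (eqP fx) !size_tuple => dimw; rewrite /free dimw size_tuple.
by rewrite !nth_fam /w addrC addKr hnormZ norm_toC_expR; exact: lt.
Qed.

(** [L] meets its orthogonal complement trivially in dimension 2n, so the complement has dimension
    at most n, which is the dimension of the image of [L] under the injective [J]. *)
Lemma lagrangian_intro L : \dim L = n -> (J E @: L <= orthov H L)%VS -> lagrangian h L.
Proof.
move=> dimL JL; apply/eqP; rewrite eq_sym eqEdim JL /=.
have -> : \dim (J E @: L) = n.
  rewrite limg_dim_eq //; apply/eqP; rewrite -subv0; apply/subvP => -[x y].
  rewrite memv_cap memv_ker memv0 lfunE /= => /andP[_].
  by rewrite /J_fun /= !xpair_eqE oppr_eq0 andbC.
have dis : (L :&: orthov H L = 0)%VS.
  apply/eqP; rewrite -subv0; apply/subvP => x; rewrite memv_cap memv0.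
  by case/andP => xL /mem_orthovP/(_ x xL)/eqP; rewrite dnorm_eq0.
have := dimvS (subvf (L + orthov H L)%VS).
by rewrite dimv_disjoint_sum // dimL dim_Ehat leq_add2l.
Qed.

(** The sign in J e_i = f_i and J f_i = - e_i. *)
Definition sg (c : bool) : Cplx R := if c then 1 else -1.

Lemma J_bvec c i : J E (bvec (c, i)) = sg c *: bvec (~~ c, i).
Proof.
rewrite lfunE /= /J_fun /bvec /sg; case: c => /=.
  by rewrite oppr0 scale1r.
by rewrite scaleN1r; congr pair; rewrite /= oppr0.
Qed.

Lemma hsum_bvec2 a b c d p q p' q' :
  H (a *: bvec p + b *: bvec q) (c *: bvec p' + d *: bvec q') =
  a * (Num.conj c * (p == p')%:R) + a * (Num.conj d * (p == q')%:R) +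
  (b * (Num.conj c * (q == p')%:R) + b * (Num.conj d * (q == q')%:R)).
Proof. by rewrite linearDl !linearDr !linearZl_LR !linearZ_LR /= !hsum_bvec. Qed.

Lemma hsum_bvec1 a b p q r :
  H (a *: bvec p + b *: bvec q) (bvec r) = a * (p == r)%:R + b * (q == r)%:R.
Proof. by rewrite linearDl !linearZl_LR /= !hsum_bvec. Qed.

Lemma exp_Ahat_bvec alpha t p :
  exp_Ahat e alpha t (bvec p) = toC (expR (t * lam alpha p)) *: bvec p.
Proof. by rewrite exp_AhatE_dop dop_bvec. Qed.

Lemma exp_Ahat_scale_bvec alpha t c p :
  exp_Ahat e alpha t (c *: bvec p) = toC (expR (t * lam alpha p)) *: (c *: bvec p).
Proof. by rewrite linearZ /= exp_Ahat_bvec !scalerA mulrC. Qed.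

Lemma lamN alpha p : lam (fun i => - alpha i) p = - lam alpha p.
Proof. by rewrite /lam; case: p.1. Qed.

Lemma span_bvec_Lambda (I : {set 'I_n}) (f : 'I_n -> 'I_n) : injective f ->
  <<fam (fun i => bvec (f i \in I, f i))>>%VS = Lambda e I.
Proof.
move=> fi; apply/eqP; rewrite LambdaE eqEdim dim_cspan card_Lidx; apply/andP; split.
  apply: fam_sub => i; apply: memv_span; apply: map_f.
  by rewrite mem_enum inE.
have /eqP-> : free (fam (fun i => bvec (f i \in I, f i))).
  apply: (free_dual (h := hsum h) (y := fun i => bvec (f i \in I, f i))) => [i j ij|i].
    by rewrite [LHS]hsum_bvec xpair_eqE (inj_eq fi) (negbTE ij) andbF.
  by rewrite [X in X != 0]hsum_bvec eqxx oner_eq0.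
by rewrite size_tuple.
Qed.

Lemma dim_Lambda I : \dim (Lambda e I) = n.
Proof. by rewrite LambdaE dim_cspan card_Lidx. Qed.

(** * Sufficiency: the explicit tunnelling subspace *)

Section Tunnelling.
Variables (K M : {set 'I_n}) (s : 'I_n -> 'I_n) (alpha : 'I_n -> R).
Hypothesis sK : involutive s.
Hypothesis s_fix : forall i, (i \in K) = (i \in M) -> s i = i.

(* The spanning vector x k is the sum of its eigenvectors of largest and smallest
   exponent, bK k and +- bM k; these coincide exactly when agree k holds. *)
Let agree i := (i \in K) == (i \in M).
Let bK i := bvec (s i \in K, s i).
Let bM i := bvec (i \in M, i).
Let x i := bK i + (if agree i then 0 else sg (i \in M)) *: bM i.

Hypothesis s_lt : forall i, ~~ agree i ->
  lam alpha (i \in M, i) < lam alpha (s i \in K, s i).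

Let agree_s i : agree (s i) = agree i.
Proof.
apply/idP/idP => ai; last by rewrite (s_fix (eqP ai)).
by move: (ai); have := s_fix (eqP ai); rewrite sK => <-.
Qed.

(** The same vector with [bM i] as leading term, as the backward limit requires. On agreeing indices
    [bK i] equals [bM i], so the remainder moves to coefficient 0. *)
Let xE i : x i = (if agree i then 1 else sg (i \in M)) *: bM i +
  (if agree i then 0 else 1) *: bK i.
Proof.
rewrite /x; case: (boolP (agree i)) => [ai|_]; last by rewrite scale1r addrC.
rewrite scale1r !scale0r !addr0 /bK /bM (s_fix (eqP ai)).
by rewrite (eqP ai).
Qed.

Let sg_neq0 c : sg c != 0.
Proof. by rewrite /sg; case: c; rewrite ?oppr_eq0 oner_eq0. Qed.

(** [bK i] equals some [bM j] only if i = j is an agreeing index, so the pairings of the [x i] with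
    the [bM j] form a diagonal matrix with entries 1 or -1. *)
Lemma tunnel_free : free (fam x).
Proof.
have bKM i j : ((s i \in K, s i) == (j \in M, j)) = (i == j) && agree j.
  rewrite xpair_eqE -[in LHS]/(agree _).
  apply/andP/andP => [[+ /eqP Eij]|[/eqP-> aj]].
    rewrite Eij => aj; have := s_fix (eqP aj); rewrite -[X in s X]Eij sK => ->.
    by rewrite eqxx.
  by rewrite (s_fix (eqP aj)).
have xM i j : H (x i) (bM j) = ((i == j) && agree j)%:R +
    (if agree i then 0 else sg (i \in M)) * (i == j)%:R.
  rewrite /x -[bK i]scale1r [LHS]hsum_bvec1 bKM mul1r xpair_eqE.
  by case: eqVneq => [->|]; rewrite ?eqxx ?andbT ?andbF.
apply: (free_dual (h := hsum h) (y := bM)) => [i j ij|i].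
  by rewrite [LHS]xM (negbTE ij) mulr0 addr0.
rewrite [X in X != 0]xM eqxx mulr1 /=.
by case: (agree i); rewrite ?addr0 ?add0r ?oner_eq0.
Qed.

Lemma tunnel_lagrangian : lagrangian h <<fam x>>%VS.
Proof.
apply: lagrangian_intro; first by rewrite (eqP tunnel_free) size_tuple.
rewrite limg_fam; apply: fam_sub => k; rewrite mem_orthov_sym.
apply: fam_sub => l; rewrite mem_orthov1_sym mem_orthov1; apply/eqP.
rewrite /x /bK /bM [J E _]linearD [X in _ + X]linearZ /= !J_bvec scalerA.
rewrite -[bvec (s l \in K, s l)]scale1r.
rewrite [LHS]hsum_bvec2 rmorph1 !mul1r.
(* [J] exchanges e_i and f_i, so the pairings of [bK] with [bK] and of [bM] with [bM] vanish. *)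
have neq c i j : ((~~ (i \in c), i) == (j \in c, j)) = false.
  by rewrite xpair_eqE; apply/andP => -[+ /eqP Eij]; rewrite Eij; case: (_ \in _).
rewrite !neq !mulr0 add0r addr0.
(* The cross pairings survive only for l = s k. There the coefficients are 0 if the indices agree;
   otherwise the two terms are -1 and 1. *)
have [<-|kl] := eqVneq (s k) l; last first.
  rewrite !xpair_eqE (negbTE kl) (_ : (k == s l) = false) ?andbF ?mulr0 ?addr0 //.
  by apply: contraNF kl => /eqP->; rewrite sK.
rewrite sK !xpair_eqE !eqxx !andbT agree_s.
have := agree_s k; rewrite /agree /sg.
by do 4?case: (_ \in _); rewrite //= ?(rmorph0, rmorphN, rmorph1, mulr0, mul0r,
  mulr1, mul1r, mulrN, mulNr, opprK, subrr, addr0, addNr, oppr0).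
Qed.

Lemma tunnel_prec : prec h e alpha K M.
Proof.
have sinj : injective s := can_inj sK.
have pM : <<fam (fun i => (if agree i then 1 else sg (i \in M)) *: bM i)%R>>%VS =
    Lambda e M.
  rewrite (span_fam_scale (c := fun i => if agree i then 1 else sg (i \in M))).
    exact: (span_bvec_Lambda M (f := id)).
  by move=> i; case: ifP; rewrite ?oner_eq0.
have pK : <<fam bK>>%VS = Lambda e K by exact: span_bvec_Lambda.
exists <<fam x>>%VS; split; split; try exact: tunnel_lagrangian.
  rewrite /Psi; under eq_fun do rewrite exp_AhatN.
  have xE' : x = fun i => (if agree i then 1 else sg (i \in M)) *: bM i +
      (if agree i then 0 else 1) *: bK i by exact/funext.
  have fx := tunnel_free; rewrite xE' in fx *.
  (* On agreeing indices the remainder is 0, an eigenvector for any exponent; the leading exponent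
     minus 1 is a placeholder meeting the strict inequality. *)
  rewrite -pM; apply: (@cvg_Psi_frame _ _ _ _ (fun i => - lam alpha (i \in M, i))
    (fun i => if agree i then - lam alpha (i \in M, i) - 1
              else - lam alpha (s i \in K, s i))) => [t i|t i|i||//].
  + by rewrite exp_Ahat_scale_bvec lamN.
  + case: ifP => _; first by rewrite !scale0r linear0 scaler0.
    by rewrite exp_Ahat_scale_bvec lamN.
  + case: ifP => [_|/negbT/s_lt]; last by rewrite ltrN2.
    by rewrite ltrBlDr ltrDl.
  + by rewrite /free pM dim_Lambda size_tuple.
rewrite -pK; apply: (@cvg_Psi_frame _ _ _ _ (fun i => lam alpha (s i \in K, s i))
  (fun i => if agree i then lam alpha (s i \in K, s i) - 1
            else lam alpha (i \in M, i))) => [t i|t i|i||].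
+ exact: exp_Ahat_bvec.
+ case: ifP => _; first by rewrite !scale0r linear0 scaler0.
  exact: exp_Ahat_scale_bvec.
+ case: ifP => [_|/negbT/s_lt //]; by rewrite ltrBlDr ltrDl.
+ by rewrite /free pK dim_Lambda size_tuple.
+ exact: tunnel_free.
Qed.

End Tunnelling.

End CoordinateFlow.

Theorem proposition4p4 (R : realType) (E : vectType (Cplx R))
    (h : hermitian_product E) (n : nat) (e : n.-tuple E)
    (e_basis : basis_of fullv e) (e_orthonormal : orthonormal h e)
    (alpha : 'I_n -> R)
    (alpha_gt0 : forall i : 'I_n, 0 < alpha i)
    (alpha_increasing : forall i j : 'I_n, (i < j)%N -> alpha i < alpha j)
    (K M : {set 'I_n}) :
  prec h e alpha K M <-> dominates K M.
Proof.
split=> [KM|/dominates_involution[s [sK s_fix s_up s_down]]].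
  by apply: card_dominates => m; exact: prec_card KM.
apply: (tunnel_prec e_basis e_orthonormal sK s_fix) => i.
rewrite /lam /=; case iK: (i \in K); case iM: (i \in M) => //= _.
  (* Here [bM i] is f_i. It is paired either with e_i, of positive exponent, or with f_(s i), where
     s i < i gives the larger exponent. *)
  have : i \in K :\: M by rewrite inE iM.
  case/s_down => [->|[]]; first by rewrite iK (lt_trans _ (alpha_gt0 i)) // oppr_lt0.
  by rewrite inE => /andP[/negbTE-> _] /alpha_increasing; rewrite ltrN2.
(* Here e_i is paired with e_(s i), and i < s i. *)
have : i \in M :\: K by rewrite inE iK.
by case/s_up; rewrite inE => /andP[_ ->] /alpha_increasing.
Qed.
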